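(* Let $n\ge 4$ be an integer. Then the logarithmic Sobolev constant $\alpha_n$ and the spectral gap $\lambda_n$ of the $n$-cycle satisfy $$\alpha_n=\frac{\lambda_n}{2}.$$
   Context: Let $C_n:=\mathbb Z/n\mathbb Z$ be the $n$-cycle. Functions $f:C_n\to\mathbb R$ are written $f=(f_i)_{i\in C_n}$, with indices taken modulo $n$. The normalized average is $\langle f\rangle:=\frac1n\sum_{i\in C_n}f_i$. The Dirichlet form is $$\mathcal E_n(f,f):=\frac1{2n}\sum_{i\in C_n}(f_i-f_{i+1})^2 .$$ The variance is $\operatorname{Var}(f):=\langle f^2\rangle-\langle f\rangle^2$. For a nonnegative function $g:C_n\to\mathbb R$ the relative entropy is $$\operatorname{Ent}(g):=\langle g\log g\rangle-\langle g\rangle\log\langle g\rangle,$$ with the convention $0\log 0=0$. The spectral gap and the logarithmic Sobolev constant are $$\lambda_n:=\inf_{f:\,\operatorname{Var}(f)>0}\frac{\mathcal E_n(f,f)}{\operatorname{Var}(f)},\qquad \alpha_n:=\inf_{f:\,\operatorname{Ent}(f^2)>0}\frac{\mathcal E_n(f,f)}{\operatorname{Ent}(f^2)},$$ where the infima are over functions $f:C_n\to\mathbb R$. (A standard Fourier computation gives $\lambda_n=1-\cos\frac{2\pi}{n}$.) *)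

(* Defs.v *)
From HB Require Import structures.
From mathcomp Require Import all_boot all_order all_algebra.
From mathcomp Require Import all_classical all_reals all_analysis.

Set Implicit Arguments.
Unset Strict Implicit.
Unset Printing Implicit Defensive.

Import Order.TTheory GRing.Theory Num.Theory.

Local Open Scope classical_set_scope.
Local Open Scope ring_scope.

(* The n-cycle is the additive group of ['Z_n], which is Z/nZ only for n >= 2;
   there [i + 1] is addition modulo n. *)

Definition cycle_average (R : realType) (n : nat) (f : 'Z_n -> R) : R :=
  n%:R^-1 * \sum_(i : 'Z_n) f i.

Definition cycle_dirichlet (R : realType) (n : nat) (f : 'Z_n -> R) : R :=
  (2 * n%:R)^-1 * \sum_(i : 'Z_n) (f i - f (i + 1)) ^+ 2.

Definition cycle_variance (R : realType) (n : nat) (f : 'Z_n -> R) : R :=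
  cycle_average (fun i => f i ^+ 2) - cycle_average f ^+ 2.

(* Meaningful for g >= 0 only. The convention 0 log 0 = 0 holds because [ln]
   is a total function, so that [0 * ln 0 = 0]. *)
Definition cycle_entropy (R : realType) (n : nat) (g : 'Z_n -> R) : R :=
  cycle_average (fun i => g i * ln (g i)) - cycle_average g * ln (cycle_average g).

(* In the next two definitions [inf] is the real infimum, which defaults to 0
   on sets that are empty or unbounded below. For n >= 2 neither happens: the
   indicator function of a point is admissible in both, and all the quotients
   are nonnegative. *)
Definition spectral_gap (R : realType) (n : nat) : R :=
  inf [set cycle_dirichlet f / cycle_variance f | f in
        [set f : 'Z_n -> R | 0 < cycle_variance f]].

Definition log_sobolev_constant (R : realType) (n : nat) : R :=
  inf [set cycle_dirichlet f / cycle_entropy (fun i => f i ^+ 2) | f in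
        [set f : 'Z_n -> R | 0 < cycle_entropy (fun i => f i ^+ 2)]].

(* Main.v *)
Require Import Defs.
From mathcomp Require Import all_boot all_order all_algebra.
From mathcomp Require Import all_classical all_reals all_analysis.
From mathcomp Require Import ring lra.
Import Order.TTheory GRing.Theory Num.Theory.
Import numFieldNormedType.Exports.
Local Open Scope classical_set_scope.
Local Open Scope ring_scope.

(** Write lambda for the spectral gap and alpha for the logarithmic Sobolev
    constant. That alpha is at most lambda / 2 is the usual linearisation: as t
    tends to 0, Ent((1 + t g)^2) = 2 t^2 Var(g) + O(t^3)
    ([entropy_perturbation_ge], [log_sobolev_constant_le_quotient]).

    For the converse, suppose that 2 E(f) < a Ent(f^2) for some f and some a
    with 0 < a < lambda; the test function which is 1 at vertex 0, -1 at
    vertex 2 and 0 elsewhere shows that lambda <= 1 when n >= 4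
    ([spectral_gap_le1]), so that a <= 1. By compactness a Ent(f^2) - 2 E(f) has
    a maximiser u at fixed l^2 norm. It is strictly positive and solves
       (u_(i+1) + u_(i-1)) / (2 u_i) = const - a ln u_i
    ([maximiser_gt0], [maximiser_euler_lagrange]). It remains to show that u is
    constant, since constants have entropy 0 ([maximiser_constant]).

    Put d_i = ln u_(i+1) - ln u_i and let eta_i be the left-hand side above, so
    that eta_i - eta_(i+1) = a d_i. The heart of the proof is
       sum (d_i - d_(i+1))^2 <= 2 a sum d_i^2          ([cycle_rigidity]),
    which, because sum d_i = 0 and a < lambda, contradicts the Poincare
    inequality unless d = 0. On the continuous circle the analogue is an
    identity: w = ln u satisfies - w'' - w'^2 = a w + const, and multiplying by
    w'' and integrating gives int w''^2 = a int w'^2, because the integral of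
    w'^2 w'' vanishes. On the cycle the cubic terms do not telescope, and two
    pointwise inequalities replace that cancellation.

    At a vertex, with x = d_(i-1), y = d_i and eta = eta_i,
       (y - x) (eta - 1 + 2 ln eta) - (3/2) (y - x)^2 >= Q(y) - Q(x)
    for a primitive Q of K(cosh t), where K(s) = s - 1 + 2 ln s
    ([vertex_inequality]). For x = y both sides vanish, and the choice of Q
    makes them agree to first order in y - x, since then eta = cosh x. The right
    side telescopes around the cycle. Summation by parts on the left, together
    with eta_i - eta_(i+1) = a d_i, bounds S - P, where S = sum d_i^2 and
    P = sum d_i d_(i+1), in terms of T = sum d_i (ln eta_i - ln eta_(i+1)):
       3 (S - P) <= a S + 2 T.
    At a bond, one shows ([bond_inequality]) that
       d_i (a (d_(i-1) + d_(i+1)) / 2 + a b d_i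
              - 2 b (ln eta_i - ln eta_(i+1))) >= 0,      b = 1 - a;
    this is where a <= 1 enters. Its sum is a P + a b S - 2 b T >= 0, and adding
    b times the vertex estimate eliminates T and leaves
    (a + 3 b) (S - P) <= a (1 + 2 b) S. As a + 3 b = 1 + 2 b > 0, this
    is S - P <= a S, which is the estimate. *)

(** * Two tools of one-variable calculus *)

(** Treats both signs of [h] at once: the hypothesis says that [f] increases
    away from 0 in the direction of [h]. *)
Lemma le_of_derive_sign {R : realType} (f df : R -> R) (h : R) :
  (forall t : R, `|t| <= `|h| -> is_derive t 1 f (df t)) ->
  (forall t, 0 < t * h -> 0 <= t * df t) -> f 0 <= f h.
Proof.
move=> fD fS; have cf (u v : R) : (forall t, t \in `[u, v]%R -> `|t| <= `|h|) ->
    {within `[u, v]%classic, continuous f}.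
  move=> uv; apply: derivable_within_continuous => t /uv th.
  by have [] := fD t th.
have [h0|h0|->] := ltgtP h 0; last by [].
- have nh t : t \in `[h, 0]%R -> `|t| <= `|h|.
    by rewrite in_itv/= => /andP[? ?]; rewrite !ler0_norm ?lerN2// ltW.
  have dh t : t \in `]h, 0[%R -> is_derive t 1 f (df t).
    by move=> /subset_itv_oo_cc/nh; exact: fD.
  have [c] := MVT h0 dh (cf _ _ nh).
  rewrite in_itv/= => /andP[hc c0] fE.
  have /fS : 0 < c * h by rewrite nmulr_rgt0.
  by nra.
- have nh t : t \in `[0, h]%R -> `|t| <= `|h|.
    by rewrite in_itv/= => /andP[? ?]; rewrite !ger0_norm// ltW.
  have dh t : t \in `]0, h[%R -> is_derive t 1 f (df t).
    by move=> /subset_itv_oo_cc/nh; exact: fD.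
  have [c] := MVT h0 dh (cf _ _ nh).
  rewrite in_itv/= => /andP[c0 ch] fE.
  have /fS : 0 < c * h by rewrite mulr_gt0.
  by nra.
Qed.

(** On a bounded interval only, so that a single base point of integration lies
    to the left of every [t]. *)
Lemma continuous_primitive {R : realType} (f : R -> R) (M : R) : continuous f ->
  exists F : R -> R, forall t : R, `|t| <= M -> is_derive t 1 F (f t).
Proof.
move=> cf.
exists (fun x => \int[lebesgue_measure]_(t in `[- M - 1, x]) f t)%R => t tM.
have /andP[Mt tM'] : - M <= t <= M by rewrite -ler_norml.
have tu : t < M + 1 by lra.
have fi : lebesgue_measure.-integrable `[- M - 1, M + 1]%classic (EFin \o f).
  apply: continuous_compact_integrable; first exact: segment_compact.
  exact: continuous_subspaceT.
have [] := continuous_FTC1_closed tu fi _ (cf t); first by lra.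
by move=> dF <-; rewrite derive1E; exact/derivableP.
Qed.

(** * Hyperbolic functions and bounds on the logarithm *)

Definition cosh {R : realType} (t : R) : R := (expR t + expR (- t)) / 2.
Definition sinh {R : realType} (t : R) : R := (expR t - expR (- t)) / 2.

Lemma is_derive_expRN {R : realType} (t : R) :
  is_derive t 1 (fun s : R => expR (- s)) (- expR (- t)).
Proof.
rewrite -mulrN1; exact: (@is_derive1_comp R expR -%R).
Qed.

Lemma is_derive_cosh {R : realType} (t : R) : is_derive t 1 (@cosh R) (sinh t).
Proof.
have -> : @cosh R = 2^-1 *: ((@expR R) + (fun s : R => expR (- s))).
  by apply/funext => s; rewrite /cosh /= mulrC.
have := is_derive_expRN t => ?.
by apply: is_derive_eq; rewrite /sinh [LHS]mulrC.
Qed.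

Lemma is_derive_sinh {R : realType} (t : R) : is_derive t 1 (@sinh R) (cosh t).
Proof.
have -> : @sinh R = 2^-1 *: ((@expR R) - (fun s : R => expR (- s))).
  by apply/funext => s; rewrite /sinh /= mulrC.
have := is_derive_expRN t => ?.
by apply: is_derive_eq; rewrite /cosh opprK [LHS]mulrC.
Qed.

Lemma cosh_gt0 {R : realType} (t : R) : 0 < cosh t.
Proof. by rewrite divr_gt0// addr_gt0// expR_gt0. Qed.

Lemma expR_cosh_sinh {R : realType} (t : R) : expR t = cosh t + sinh t.
Proof. by rewrite /cosh /sinh; field. Qed.

Lemma coshN {R : realType} (t : R) : cosh (- t) = cosh t.
Proof. by rewrite /cosh opprK addrC. Qed.

Lemma sinhN {R : realType} (t : R) : sinh (- t) = - sinh t.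
Proof. by rewrite /sinh opprK; field. Qed.

Lemma expRN_cosh_sinh {R : realType} (t : R) : expR (- t) = cosh t - sinh t.
Proof. by rewrite expR_cosh_sinh coshN sinhN. Qed.

Lemma sinh2E {R : realType} (t : R) : sinh t ^+ 2 = cosh t ^+ 2 - 1.
Proof.
have := expRxMexpNx_1 t; rewrite expRN_cosh_sinh expR_cosh_sinh.
by rewrite mulrC -subr_sqr => <-; ring.
Qed.

Lemma coshD {R : realType} (s t : R) :
  cosh (s + t) = cosh s * cosh t + sinh s * sinh t.
Proof. by rewrite /cosh /sinh opprD !expRD; field. Qed.

Lemma sinhD {R : realType} (s t : R) :
  sinh (s + t) = sinh s * cosh t + cosh s * sinh t.
Proof. by rewrite /cosh /sinh opprD !expRD; field. Qed.

Lemma cosh_ge1 {R : realType} (t : R) : 1 <= cosh t.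
Proof.
have := sinh2E t; have := sqr_ge0 (sinh t); have := cosh_gt0 t; nra.
Qed.

Lemma sinh0 {R : realType} : sinh 0 = 0 :> R.
Proof. by rewrite /sinh oppr0 subrr mul0r. Qed.

Lemma sinh_ge_id {R : realType} (t : R) : 0 <= t -> t <= sinh t.
Proof.
move=> t0; rewrite -subr_ge0.
have -> : 0 = sinh 0 - 0 :> R by rewrite sinh0 subrr.
apply: (@le_of_derive_sign R (@sinh R - id) (fun s => cosh s - 1)).
  by move=> s _; have := is_derive_sinh s => ?; exact: is_deriveB.
move=> s st; have s0 : 0 <= s by nra.
by rewrite mulr_ge0// subr_ge0 cosh_ge1.
Qed.

Lemma sinh_ge0 {R : realType} (t : R) : 0 <= t -> 0 <= sinh t.
Proof. by move=> t0; exact: le_trans (sinh_ge_id t t0). Qed.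

Lemma sinh_le_id_cosh {R : realType} (t : R) : 0 <= t -> sinh t <= t * cosh t.
Proof.
move=> t0; rewrite -subr_ge0.
have -> : 0 = 0 * cosh 0 - sinh 0 :> R by rewrite sinh0 subr0 mul0r.
apply: (@le_of_derive_sign R (id * @cosh R - @sinh R) (fun s => s * sinh s)).
  move=> s _; have := is_derive_sinh s => ?; have := is_derive_cosh s => ?.
  by apply: is_derive_eq; rewrite /GRing.scale /=; ring.
move=> s st; have s0 : 0 <= s by nra.
by do 2!apply: mulr_ge0 => //; exact: sinh_ge0.
Qed.

(** The bound [t <= sinh t] at [t = ln r]. *)
Lemma ln_le_sub_inv {R : realType} (r : R) : 1 <= r -> 2 * ln r <= r - r^-1.
Proof.
move=> r1; have r0 : r \is Num.pos by rewrite posrE (lt_le_trans _ r1).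
have := sinh_ge_id (ln r) (ln_ge0 r1).
by rewrite /sinh expRN lnK//; lra.
Qed.

(** The bound [tanh s <= s] at [s = ln r / 2]. *)
Lemma ln_ge_pade {R : realType} (r : R) :
  1 <= r -> 2 * (r - 1) <= ln r * (r + 1).
Proof.
move=> r1; have r0 : r \is Num.pos by rewrite posrE (lt_le_trans _ r1).
set t := ln r; have t0 : 0 <= t / 2 by rewrite divr_ge0// ln_ge0.
have := sinh_le_id_cosh (t / 2) t0.
have -> : r = expR (t / 2) ^+ 2 by rewrite -expRM_natr divfK ?lnK.
have := expRxMexpNx_1 (t / 2); rewrite /sinh /cosh.
have := expR_gt0 (t / 2).
set e := expR _; set e' := expR _ => e0 ee' H.
have : (e - e') / 2 * (4 * e) <= t / 2 * ((e + e') / 2) * (4 * e).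
  by rewrite ler_pM2r// mulr_gt0.
have -> : (e - e') / 2 * (4 * e) = 2 * (e ^+ 2 - e * e') by field.
have -> : t / 2 * ((e + e') / 2) * (4 * e) = t * (e ^+ 2 + e * e') by field.
by rewrite ee'.
Qed.

Lemma ln_le_sub1 {R : realType} (r : R) : 0 < r -> ln r <= r - 1.
Proof.
by move=> r0; rewrite -[in ln r](subrKC 1 r) le_ln1Dx// ltrBrDl subrr.
Qed.

Lemma ln_sqr {R : realType} (r : R) : 0 < r -> ln (r ^+ 2) = 2 * ln r.
Proof. by move=> r0; rewrite lnXn// mulr_natl. Qed.

(** This bound and the next give the sign of the derivative in
    [vertex_inequality], for [h >= 0] and for [h <= 0]. Here [c = 1] is the
    worst case for both sides; there the left side is [2 ln (cosh h)]. *)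
Lemma ln_1Dsinh_sqr_le {R : realType} (c h : R) : 1 <= c -> 0 <= h ->
  ln (1 + (sinh h / c) ^+ 2) <= c * (sinh h + h * expR h) - 2 * h.
Proof.
move=> c1 h0; have c0 : 0 < c := lt_le_trans ltr01 c1.
have s0 := sinh_ge0 h h0; have hs := sinh_ge_id h h0.
have shc := sinh_le_id_cosh h h0.
have C0 := cosh_gt0 h; have C1 := cosh_ge1 h.
have le1 : ln (1 + (sinh h / c) ^+ 2) <= ln (cosh h ^+ 2).
  rewrite ler_ln ?posrE ?exprn_gt0 ?ltr_wpDr ?sqr_ge0//.
  rewrite -lerBrDl -sinh2E exprMn ler_piMr ?sqr_ge0//.
  by rewrite exprVn invf_le1 ?exprn_gt0// exprn_ege1.
apply: (le_trans le1); rewrite ln_sqr//.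
apply: (le_trans (ln_le_sub_inv _ C1)).
have -> : cosh h - (cosh h)^-1 = sinh h * (sinh h / cosh h).
  by rewrite mulrA -expr2 sinh2E; field; rewrite gt_eqF.
have le2 : sinh h / cosh h <= h by rewrite ler_pdivrMr.
have : sinh h * (sinh h / cosh h) <= sinh h * h by rewrite ler_wpM2l.
move/le_trans; apply.
have le3 : sinh h + h * expR h <= c * (sinh h + h * expR h).
  by rewrite ler_peMl// addr_ge0// mulr_ge0// expR_ge0.
rewrite lerBrDr; apply: le_trans le3.
by rewrite expR_cosh_sinh; nra.
Qed.

(** At [c = 1] the two sides agree to second order in [h], so the logarithms
    need bounds exact to that order. In the variable [q = exp h] those of
    [ln_le_sub_inv] and [ln_ge_pade] reduce the claim to the sign of a rational
    function with a triple zero at [q = 1]. *)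
Lemma ln_1Dsinh_sqr_ge {R : realType} (c h : R) : 1 <= c -> h <= 0 ->
  c * (sinh h + h * expR h) - 2 * h <= ln (1 + (sinh h / c) ^+ 2).
Proof.
move=> c1 h0; have c0 : 0 < c := lt_le_trans ltr01 c1.
have [p p0 hE] : exists2 p, 0 <= p & h = - p by exists (- h); lra.
rewrite {}hE in h0 *; rewrite sinhN.
set s := sinh p; have s0 : 0 <= s := sinh_ge0 p p0.
have q0 := expR_gt0 (- p); set q := expR (- p) in q0 *.
have pc : q <= 1 by rewrite expR_le1 oppr_le0.
rewrite (mulNr s) sqrrN.
have pos : 0 < 1 + (s / c) ^+ 2 by rewrite ltr_wpDr ?sqr_ge0.
have pos1 : 0 < 1 + s ^+ 2 by rewrite ltr_wpDr ?sqr_ge0.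
(* It suffices to treat c = 1, as the error is absorbed by (c - 1) * s. *)
have red : ln (1 + s ^+ 2) <= ln (1 + (s / c) ^+ 2) + (c - 1) * s.
  rewrite -lerBlDl -ln_div ?posrE//.
  apply: (le_trans (ln_le_sub1 _ _)); first by rewrite divr_gt0.
  have -> : (1 + s ^+ 2) / (1 + (s / c) ^+ 2) - 1 =
      (c - 1) * s * (s * (c + 1) / (c ^+ 2 + s ^+ 2)).
    by field; rewrite !gt_eqF//; nra.
  have cs0 : 0 <= (c - 1) * s by apply: mulr_ge0; lra.
  have cs1 : s * (c + 1) <= c ^+ 2 + s ^+ 2 by have := sqr_ge0 (c - s); nra.
  have cs2 : 0 < c ^+ 2 + s ^+ 2 by nra.
  by apply: ler_piMr => //; rewrite ler_pdivrMr// mul1r.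
suff base : 0 <= s + p * q - 2 * p + ln (1 + s ^+ 2).
  have : 0 <= (c - 1) * (p * q) by rewrite !mulr_ge0 ?subr_ge0// ltW.
  by nra.
have qE : q^-1 = expR p by rewrite /q expRN invrK.
have sE : s = (q^-1 - q) / 2 by rewrite qE.
have CE : cosh p = (q^-1 + q) / 2 by rewrite qE.
have rpos : 0 < 1 + q ^+ 2 by nra.
(* The left side is 2 ln (cosh p), and cosh p = exp p * (1 + q ^+ 2) / 2. *)
have lnE : ln (1 + s ^+ 2) = 2 * p - 2 * ln (2 / (1 + q ^+ 2)).
  rewrite sinh2E subrKC ln_sqr ?cosh_gt0// -mulrBr; congr (_ * _).
  have -> : cosh p = q^-1 / (2 / (1 + q ^+ 2)).
    by rewrite CE; field; rewrite !gt_eqF.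
  by rewrite ln_div ?posrE ?invr_gt0 ?divr_gt0// qE expRK.
have r1 : 1 <= 2 / (1 + q ^+ 2) by rewrite ler_pdivlMr//; nra.
have H1 := ln_le_sub_inv _ r1.
have H2 := ln_ge_pade q^-1.
rewrite qE expRK -qE invf_ge1// in H2; have {}H2 := H2 pc.
have pq : 2 * (1 - q) / (1 + q) <= p.
  rewrite ler_pdivrMr; last by lra.
  rewrite -(ler_pM2r (x := q^-1)) ?invr_gt0//.
  have -> : 2 * (1 - q) / q = 2 * (q^-1 - 1) by field; rewrite gt_eqF.
  have -> : p * (1 + q) / q = p * (q^-1 + 1) by field; rewrite gt_eqF.
  by [].
have pq' : 2 * (1 - q) / (1 + q) * q <= p * q by rewrite ler_pM2r.
rewrite lnE sE; move: H1 pq'; rewrite invf_div => H1 pq'.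
have key : 0 <= (q^-1 - q) / 2 + 2 * (1 - q) / (1 + q) * q
    - (2 / (1 + q ^+ 2) - (1 + q ^+ 2) / 2).
  have -> : (q^-1 - q) / 2 + 2 * (1 - q) / (1 + q) * q
      - (2 / (1 + q ^+ 2) - (1 + q ^+ 2) / 2) =
      (1 - q) ^+ 3 * (1 + q + q ^+ 2 - q ^+ 3) /
      (2 * q * (1 + q) * (1 + q ^+ 2)).
    by field; rewrite !gt_eqF//; lra.
  rewrite divr_ge0//; last by rewrite !mulr_ge0//; nra.
  rewrite mulr_ge0 ?exprn_ge0 ?subr_ge0//.
  have : q ^+ 3 <= q ^+ 2 by rewrite ler_wiXn2l// ltW.
  by nra.
lra.
Qed.

(** * The vertex and bond inequalities *)

(** For a positive function [u] on the cycle, with [x] and [y] the increments of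
    [ln u] before and after vertex [i], this is
    [(u (i + 1) + u (i - 1)) / (2 * u i)]. *)
Definition neighbour_ratio {R : realType} (x y : R) : R :=
  (expR y + expR (- x)) / 2.

Lemma neighbour_ratio_gt0 {R : realType} (x y : R) : 0 < neighbour_ratio x y.
Proof. by rewrite divr_gt0// addr_gt0// expR_gt0. Qed.

(** Reversing the orientation of the cycle exchanges [x] with [- y]. *)
Lemma neighbour_ratioN {R : realType} (x y : R) :
  neighbour_ratio (- y) (- x) = neighbour_ratio x y.
Proof. by rewrite /neighbour_ratio opprK addrC. Qed.

(** With [m = (x + y) / 2] and [h = (y - x) / 2] the ratio is [cosh m * expR h].
    For fixed [m], half the difference of the two sides is a function [G] of [h]
    which vanishes at 0, and its derivative has the sign of [h]. The identity
    [cosh (m + t) * cosh (m - t) = cosh m ^+ 2 + sinh t ^+ 2] brings that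
    derivative into the form of the two preceding bounds. *)
Lemma vertex_inequality {R : realType} (L : R -> R) (M x y : R) :
  (forall t : R, `|t| <= M -> is_derive t 1 L (ln (cosh t))) ->
  `|x| <= M -> `|y| <= M ->
  (sinh y - y + 2 * L y) - (sinh x - x + 2 * L x) <=
  (y - x) * (neighbour_ratio x y - 1 + 2 * ln (neighbour_ratio x y))
    - 3 / 2 * (y - x) ^+ 2.
Proof.
move=> dL /ler_normlP[x1 x2] /ler_normlP[y1 y2].
pose m := (x + y) / 2; pose h := (y - x) / 2; pose c := cosh m.
have c1 : 1 <= c := cosh_ge1 m; have c0 : 0 < c := cosh_gt0 m.
pose G t := c * (t * expR t) - t ^+ 2 + 2 * ln c * t - c * sinh t
  - (L (m + t) - L (m - t)).
pose dG t := c * (sinh t + t * expR t) - 2 * t - ln (1 + (sinh t / c) ^+ 2).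
have G_le : G 0 <= G h.
  apply: (@le_of_derive_sign R G dG) => [t th|t th]; last first.
    have [t0|t0] := leP 0 t.
      by rewrite /dG mulr_ge0// subr_ge0; exact: ln_1Dsinh_sqr_le.
    apply: mulr_le0; first exact: ltW.
    by rewrite subr_le0; apply: ln_1Dsinh_sqr_ge => //; exact: ltW.
  have tM : `|m + t| <= M /\ `|m - t| <= M.
    have : `|t| <= M - `|m|.
      apply: (le_trans th); rewrite lerBrDr /h /m.
      rewrite !normrM (ger0_norm (x := 2^-1)) ?invr_ge0//.
      by case: (ger0P (y - x)); case: (ger0P (x + y)); lra.
    split; [have := ler_normD m t|have := ler_normB m t]; lra.
  have [tM1 tM2] := tM.
  have dL1 : is_derive t 1 (fun s => L (m + s)) (ln (cosh (m + t))).
    rewrite -[X in is_derive _ _ _ X]mulr1.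
    apply: (@is_derive1_comp R L (fun s => m + s)); first exact: dL.
    by rewrite -[X in is_derive _ _ _ X]add0r; exact: (is_deriveD (f := cst m)).
  have dL2 : is_derive t 1 (fun s => L (m - s)) (- ln (cosh (m - t))).
    rewrite -mulrN1.
    apply: (@is_derive1_comp R L (fun s => m - s)); first exact: dL.
    by rewrite -[X in is_derive _ _ _ X]sub0r; exact: (is_deriveB (f := cst m)).
  have ds := is_derive_sinh t.
  rewrite /G; apply: is_derive_eq.
  have lnE : ln (cosh (m + t)) + ln (cosh (m - t)) =
      2 * ln c + ln (1 + (sinh t / c) ^+ 2).
    rewrite -ln_sqr// -!lnM ?posrE ?cosh_gt0 ?exprn_gt0//; last first.
      by rewrite ltr_wpDr ?sqr_ge0.
    congr ln; rewrite !coshD coshN sinhN -/c.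
    have -> : c ^+ 2 * (1 + (sinh t / c) ^+ 2) = c ^+ 2 + sinh t ^+ 2.
      by field; rewrite gt_eqF.
    have := sinh2E m; have := sinh2E t; rewrite -/c => st sm.
    transitivity (c ^+ 2 * cosh t ^+ 2 - sinh m ^+ 2 * sinh t ^+ 2); first ring.
    by rewrite sm st; ring.
  rewrite opprK lnE /dG /GRing.scale /= expR_cosh_sinh; ring.
have G0 : G 0 = 0 by rewrite /G sinh0 addr0 subr0; ring.
have := G_le; rewrite G0 /G.
have hx : m - h = x by rewrite /m /h; field.
have hy : m + h = y by rewrite /m /h; field.
rewrite hx hy.
have etaE : neighbour_ratio x y = c * expR h.
  by rewrite /neighbour_ratio -hx -hy /c /cosh opprB !expRD; field.
have lneta : ln (neighbour_ratio x y) = ln c + h.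
  by rewrite etaE lnM ?posrE ?expR_gt0// expRK.
have sE : sinh y - sinh x = 2 * c * sinh h.
  by rewrite -hx -hy !sinhD coshN sinhN /c; ring.
have yx : y - x = 2 * h by rewrite /h; field.
rewrite lneta etaE yx => ?.
have -> : sinh y - y + 2 * L y - (sinh x - x + 2 * L x) =
  (sinh y - sinh x) - (y - x) + 2 * (L y - L x) by ring.
rewrite sE yx; nra.
Qed.

(** Equivalently [2 ln r - r + r^-1] is nonincreasing. Taking the square root of
    [u / v] turns the difference of the two sides into a square. *)
Lemma ln_sub_le {R : realType} (u v : R) : 0 < v -> v <= u ->
  2 * (ln u - ln v) <= (u - v) * (1 + (u * v)^-1).
Proof.
move=> v0 vu; have u0 : 0 < u := lt_le_trans v0 vu.
pose k := Num.sqrt (u / v).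
have r1 : 1 <= u / v by rewrite ler_pdivlMr ?mul1r.
have k2 : k ^+ 2 = u / v by rewrite sqr_sqrtr// (le_trans _ r1).
have k1 : 1 <= k by rewrite -sqrtr1 ler_wsqrtr.
have k0 : 0 < k := lt_le_trans ltr01 k1.
have uE : u = k ^+ 2 * v by rewrite k2 divfK// gt_eqF.
have -> : ln u - ln v = 2 * ln k by rewrite -ln_div ?posrE// -k2 ln_sqr.
apply: (@le_trans _ _ (2 * (k - k^-1))).
  by rewrite ler_pM2l//; exact: ln_le_sub_inv.
rewrite -subr_ge0 uE.
have -> : (k ^+ 2 * v - v) * (1 + (k ^+ 2 * v * v)^-1) - 2 * (k - k^-1) =
    (k ^+ 2 - 1) * (k * v - 1) ^+ 2 / (k ^+ 2 * v).
  by field; rewrite !gt_eqF.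
apply: divr_ge0; last by apply: mulr_ge0; rewrite ?sqr_ge0 ?ltW.
by apply: mulr_ge0; rewrite ?sqr_ge0// subr_ge0 exprn_ege1.
Qed.

(** With [B = (expR z + expR (- x)) / 2] the relation between the two ratios
    reads [B * tanh ((x + z) / 2) = sinh y - a * y >= (1 - a) * y], so
    [(x + z) / 2 >= (1 - a) * y / B]. The product of the ratios is at least
    [B], and [ln_sub_le] bounds the difference of their logarithms. *)
Lemma bond_inequality_nonneg {R : realType} (a x y z : R) :
  0 < a <= 1 -> 0 <= y ->
  neighbour_ratio x y - neighbour_ratio y z = a * y ->
  0 <= a * ((x + z) / 2) + a * (1 - a) * y
       - 2 * (1 - a) * (ln (neighbour_ratio x y) - ln (neighbour_ratio y z)).
Proof.
move=> /andP[a0 a1] y0 yE.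
pose b := 1 - a; have b0 : 0 <= b by rewrite subr_ge0.
have u0 := neighbour_ratio_gt0 x y; have v0 := neighbour_ratio_gt0 y z.
set u := neighbour_ratio x y in yE u0 *.
set v := neighbour_ratio y z in yE v0 *.
have ay0 : 0 <= a * y by rewrite mulr_ge0// ltW.
have vu : v <= u by rewrite -subr_ge0 yE.
pose B := (expR z + expR (- x)) / 2.
have B0 : 0 < B by rewrite divr_gt0// addr_gt0// expR_gt0.
pose t := (x + z) / 2; pose E := expR ((z - x) / 2).
have E0 : 0 < E := expR_gt0 _.
have zE : (z - x) / 2 + t = z by rewrite /t; field.
have xE : (z - x) / 2 - t = - x by rewrite /t; field.
have BE : B = E * cosh t by rewrite /B /E /cosh mulrA mulrDr -!expRD zE xE.
have gE : sinh y - a * y = E * sinh t.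
  rewrite /E {2}/sinh mulrA mulrBr -!expRD zE xE.
  by rewrite -yE /u /v /neighbour_ratio /sinh; field.
have sy := sinh_ge_id y y0.
have g0 : b * y <= E * sinh t by rewrite -gE /b; lra.
have st0 : 0 <= sinh t.
  by rewrite -(pmulr_rge0 _ E0); apply: le_trans g0; rewrite mulr_ge0.
have t0 : 0 <= t.
  rewrite leNgt; apply/negP => t0.
  have : 0 < - t by rewrite oppr_gt0.
  move=> /[dup] /ltW /sinh_ge_id; rewrite sinhN; lra.
have tB : b * y <= t * B.
  apply: (le_trans g0); rewrite BE [leRHS]mulrCA ler_pM2l//.
  exact: sinh_le_id_cosh.
have suv : u + v = B + cosh y by rewrite /u /v /neighbour_ratio /B /cosh; field.
have C1 := cosh_ge1 y; have S2 := sinh2E y.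
(* 4 (u v - B) = (B - 1)^2 + 2 B (cosh y - 1) + (sinh y)^2 - (a y)^2, and
   a y <= y <= sinh y. *)
have uvB : B <= u * v.
  have : (u + v) ^+ 2 - (u - v) ^+ 2 = 4 * (u * v) by ring.
  rewrite suv yE => uvE.
  have : (a * y) ^+ 2 <= sinh y ^+ 2.
    by rewrite ler_sqr ?nnegrE//; nra.
  have : 0 <= B * (cosh y - 1) by apply: mulr_ge0; lra.
  have := sqr_ge0 (B - 1); nra.
have uv0 : 0 < u * v by rewrite mulr_gt0.
have t1 : b * y / (u * v) <= t.
  by rewrite ler_pdivrMr//; apply: (le_trans tB); rewrite ler_wpM2l.
have := ln_sub_le u v v0 vu; rewrite yE => H.
have : b * (2 * (ln u - ln v)) <= b * (a * y * (1 + (u * v)^-1)).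
  by rewrite ler_wpM2l.
have : a * (b * y / (u * v)) <= a * t by rewrite ler_pM2l.
rewrite -/t -/b; lra.
Qed.

Lemma bond_inequality {R : realType} (a x y z : R) : 0 < a <= 1 ->
  neighbour_ratio x y - neighbour_ratio y z = a * y ->
  0 <= y * (a * ((x + z) / 2) + a * (1 - a) * y
       - 2 * (1 - a) * (ln (neighbour_ratio x y) - ln (neighbour_ratio y z))).
Proof.
move=> a01 yE; have [y0|y0] := leP 0 y.
  by rewrite mulr_ge0//; exact: bond_inequality_nonneg.
rewrite -mulrNN; apply: mulr_ge0; first by rewrite oppr_ge0 ltW.
have := @bond_inequality_nonneg R a (- z) (- y) (- x) a01.
rewrite !neighbour_ratioN oppr_ge0 => /(_ (ltW y0)) /= H.
have -> : - (a * ((x + z) / 2) + a * (1 - a) * y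
    - 2 * (1 - a) * (ln (neighbour_ratio x y) - ln (neighbour_ratio y z))) =
    a * ((- z + - x) / 2) + a * (1 - a) * - y
    - 2 * (1 - a) * (ln (neighbour_ratio y z) - ln (neighbour_ratio x y)).
  by field.
by apply: H; rewrite mulrN -yE opprB.
Qed.

(** * Summation around the cycle *)

Lemma sum_cycle_shift {R : realType} {n : nat} (F : 'Z_n -> R) :
  \sum_i F (i + 1) = \sum_i F i.
Proof. by rewrite [RHS](reindex_inj (addIr 1)). Qed.

Lemma sum_cycle_diffsq {R : realType} {n : nat} (d : 'Z_n -> R) :
  \sum_i (d i - d (i + 1)) ^+ 2 =
  2 * (\sum_i d i ^+ 2 - \sum_i d i * d (i + 1)).
Proof.
transitivity (\sum_i (d i ^+ 2 + d (i + 1) ^+ 2 - 2 * (d i * d (i + 1)))).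
  by apply: eq_bigr => i _; ring.
rewrite sumrB big_split/= (sum_cycle_shift (fun i => d i ^+ 2)) -mulr_sumr.
ring.
Qed.

Lemma continuous_ln_cosh {R : realType} : continuous (fun t : R => ln (cosh t)).
Proof.
move=> t; apply: (@continuous_comp _ _ _ (@cosh R) (@ln R)).
  apply/differentiable_continuous/derivable1_diffP.
  by have [] := is_derive_cosh t.
exact/continuous_ln/cosh_gt0.
Qed.

(** The vertex inequality bounds the left side from above by a sum [T] of
    logarithms of ratios, the bond inequality bounds [T]; the weight [1 - a] on
    the former makes [T] cancel. *)
Lemma cycle_rigidity {R : realType} {n : nat} (a : R) (d : 'Z_n -> R) :
  0 < a <= 1 ->
  (forall i, neighbour_ratio (d (i - 1)) (d i)
    - neighbour_ratio (d i) (d (i + 1)) = a * d i) ->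
  \sum_i (d i - d (i + 1)) ^+ 2 <= 2 * a * \sum_i d i ^+ 2.
Proof.
move=> a01 dE; have [a0 a1] := andP a01.
pose M := \sum_i `|d i|.
have dM i : `|d i| <= M by rewrite /M (bigD1 i)//= ler_wpDr ?sumr_ge0.
have [L dL] := continuous_primitive _ M (@continuous_ln_cosh R).
pose eta i := neighbour_ratio (d (i - 1)) (d i).
have etaS i : neighbour_ratio (d i) (d (i + 1)) = eta (i + 1).
  by rewrite /eta addrK.
pose K i := eta i - 1 + 2 * ln (eta i).
pose S := \sum_i d i ^+ 2; pose P := \sum_i d i * d (i + 1).
pose T := \sum_i d i * (ln (eta i) - ln (eta (i + 1))).
have vert : 3 * (S - P) <= a * S + 2 * T.
  have : 0 <= \sum_i ((d i - d (i - 1)) * K i - 3 / 2 * (d i - d (i - 1)) ^+ 2).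
    pose Q t := sinh t - t + 2 * L t.
    have Q0 : \sum_i (Q (d i) - Q (d (i - 1))) = 0.
      rewrite sumrB -[X in _ - X]sum_cycle_shift.
      by under [X in _ - X]eq_bigr do rewrite addrK; rewrite subrr.
    rewrite -{1}Q0; apply: ler_sum => i _.
    exact: vertex_inequality dL (dM _) (dM _).
  rewrite sumrB -mulr_sumr.
  have -> : \sum_i (d i - d (i - 1)) ^+ 2 = 2 * (S - P).
    rewrite -sum_cycle_diffsq -[LHS]sum_cycle_shift.
    by apply: eq_bigr => i _; rewrite addrK -sqrrN opprB.
  have -> : \sum_i (d i - d (i - 1)) * K i = a * S + 2 * T.
    transitivity (\sum_i (d i * K i - d (i - 1) * K i)).
      by apply: eq_bigr => i _; rewrite mulrBl.
    rewrite sumrB -[X in _ - X]sum_cycle_shift -sumrB mulr_sumr mulr_sumr.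
    rewrite -big_split.
    apply: eq_bigr => i _ /=; rewrite addrK -mulrBr.
    have : eta i - eta (i + 1) = a * d i by rewrite -etaS dE.
    rewrite /K => etaE; transitivity (d i * ((eta i - eta (i + 1)) +
      2 * (ln (eta i) - ln (eta (i + 1))))); first by ring.
    by rewrite etaE; ring.
  by lra.
have bond : 0 <= a * P + a * (1 - a) * S - 2 * (1 - a) * T.
  have : 0 <= \sum_i d i * (a * ((d (i - 1) + d (i + 1)) / 2)
      + a * (1 - a) * d i - 2 * (1 - a) * (ln (eta i) - ln (eta (i + 1)))).
    by apply: sumr_ge0 => i _; rewrite -etaS; exact: bond_inequality a01 (dE i).
  have PE : \sum_i d i * d (i - 1) = P.
    rewrite -[LHS]sum_cycle_shift.
    by apply: eq_bigr => i _; rewrite addrK mulrC.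
  congr (0 <= _).
  transitivity (\sum_i (a / 2 * (d i * d (i - 1)) + a / 2 * (d i * d (i + 1))
      + a * (1 - a) * d i ^+ 2
      - 2 * (1 - a) * (d i * (ln (eta i) - ln (eta (i + 1)))))).
    by apply: eq_bigr => i _; field.
  by rewrite sumrB !big_split/= -!mulr_sumr PE -/P -/S -/T; field.
rewrite sum_cycle_diffsq -/S -/P.
have : 0 <= (3 - 2 * a) * (a * S - (S - P)).
  have : (1 - a) * (3 * (S - P)) <= (1 - a) * (a * S + 2 * T).
    by rewrite ler_wpM2l// subr_ge0.
  by nra.
rewrite pmulr_rge0; last by lra.
by rewrite subr_ge0 => ?; nra.
Qed.

(** * Existence of a maximiser *)

Definition xlnx {R : realType} (s : R) : R := s * ln s.

Lemma ln_ge_1sub_inv {R : realType} (r : R) : 0 < r -> 1 - r^-1 <= ln r.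
Proof.
move=> r0; have := ln_le_sub1 r^-1; rewrite invr_gt0 => /(_ r0).
by rewrite lnV ?posrE//; lra.
Qed.

(** Convexity of [xlnx], including at the boundary point [s = 0]. *)
Lemma xlnx_tangent {R : realType} (r s : R) : 0 < r -> 0 <= s ->
  xlnx r + (1 + ln r) * (s - r) <= xlnx s.
Proof.
rewrite /xlnx le_eqVlt => r0 /orP[/eqP<-|s0]; first by rewrite mul0r sub0r; lra.
have := ln_ge_1sub_inv (s / r) (divr_gt0 s0 r0).
rewrite ln_div ?posrE// invf_div => H.
have : s * (1 - r / s) <= s * (ln s - ln r) by rewrite ler_pM2l.
have -> : s * (1 - r / s) = s - r by field; rewrite gt_eqF.
by nra.
Qed.

Lemma xlnx_scale {R : realType} (c s : R) : 0 < c -> 0 <= s ->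
  xlnx (c * s) = c * xlnx s + xlnx c * s.
Proof.
rewrite /xlnx le_eqVlt => c0 /orP[/eqP<-|s0].
  by rewrite !(mulr0, mul0r) addr0.
by rewrite lnM ?posrE//; ring.
Qed.

Lemma continuous_xlnx_sqr {R : realType} :
  continuous (fun r : R => xlnx (r ^+ 2)).
Proof.
move=> r; have [->|r0] := eqVneq r 0.
  apply/cvgrPdist_le => e e0.
  near=> s.
  rewrite /xlnx expr0n mul0r sub0r normrN.
  have [->|s0] := eqVneq s 0; first by rewrite expr0n mul0r normr0 ltW.
  have s1 : `|s| <= 1 by near: s; exact: (@nbhs0_le _ R).
  have se : `|s| <= e / 2 by near: s; apply: (@nbhs0_le _ R); rewrite divr_gt0.
  have sn0 : 0 < `|s| by rewrite normr_gt0.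
  rewrite -real_normK ?num_real// ln_sqr//.
  have := ln_ge_1sub_inv _ sn0 => l1; have := ln_le0 s1 => l2.
  have : `|s| ^+ 2 * (1 - `|s|^-1) <= `|s| ^+ 2 * ln `|s|.
    by rewrite ler_pM2l// exprn_gt0.
  have -> : `|s| ^+ 2 * (1 - `|s|^-1) = `|s| ^+ 2 - `|s|.
    by field; rewrite gt_eqF.
  have l4 : `|s| ^+ 2 * ln `|s| <= 0.
    by apply: mulr_ge0_le0 => //; exact: sqr_ge0.
  by have := sqr_ge0 `|s|; rewrite mulrCA ler_norml; lra.
apply: cvgM; first exact: exprn_continuous.
apply: (@continuous_comp _ _ _ (fun r : R => r ^+ 2) (@ln R)).
  exact: exprn_continuous.
by apply: continuous_ln; rewrite exprn_even_gt0.
Unshelve. all: by end_near.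
Qed.

(** On [\sum_i f i ^+ 2 = 1] this is [n * (a / 2 * Ent(f^2) - E(f))] up to an
    additive constant. *)
Definition free_energy {R : realType} {n : nat} (a : R) (f : 'Z_n -> R) : R :=
  a / 2 * \sum_i xlnx (f i ^+ 2) - 2^-1 * \sum_i (f i - f (i + 1)) ^+ 2.

(** The unit sphere, seen in row vectors so as to be a subset of a normed space,
    is compact. *)
Lemma free_energy_maximiser {R : realType} {n : nat} (a : R) :
  exists2 u : 'Z_n -> R, \sum_i u i ^+ 2 = 1 &
    forall f : 'Z_n -> R, \sum_i f i ^+ 2 = 1 ->
      free_energy a f <= free_energy a u.
Proof.
pose N (v : 'rV[R]_(Zp_trunc n).+2) : R := \sum_(i : 'Z_n) v 0 i ^+ 2.
pose F (v : 'rV[R]_(Zp_trunc n).+2) : R :=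
  free_energy a (fun i : 'Z_n => v 0 i).
have cc (i : 'Z_n) : continuous (fun v : 'rV[R]_(Zp_trunc n).+2 => v 0 i).
  exact: coord_continuous.
have csum (G : 'Z_n -> 'rV[R]_(Zp_trunc n).+2 -> R) :
    (forall i, continuous (G i)) -> continuous (fun v => \sum_i G i v).
  by move=> cG; apply: continuous_big => //; exact: add_continuous.
have csqr (g : 'rV[R]_(Zp_trunc n).+2 -> R) : continuous g ->
    continuous (fun v => g v ^+ 2).
  move=> cg v; apply: (@continuous_comp _ _ _ g (fun r : R => r ^+ 2)).
    exact: cg.
  exact: exprn_continuous.
have cN : continuous N by apply: csum => i; apply: csqr.
have cF : continuous F.
  have cF1 : continuous (fun v : 'rV[R]_(Zp_trunc n).+2 =>
      \sum_(i : 'Z_n) xlnx (v 0 i ^+ 2)).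
    apply: csum => i v.
    apply: (@continuous_comp _ _ _ _ (fun r : R => xlnx (r ^+ 2))).
      exact: cc.
    exact: continuous_xlnx_sqr.
  have cF2 : continuous (fun v : 'rV[R]_(Zp_trunc n).+2 =>
      \sum_(i : 'Z_n) (v 0 i - v 0 (i + 1)) ^+ 2).
    apply: csum => i; apply: csqr => v.
    exact: (cvgB (cc i v) (cc (i + 1) v)).
  move=> v; apply: (@cvgB _ _ _ (nbhs v)).
    by apply: (@cvgM _ _ (nbhs v)); [exact: cvg_cst|exact: cF1].
  by apply: (@cvgM _ _ (nbhs v)); [exact: cvg_cst|exact: cF2].
pose A := [set v | N v = 1].
have cA : compact A.
  apply: (@subclosed_compact _ _
      [set v : 'rV[R]_(Zp_trunc n).+2 | forall i, `[-1, 1]%classic (v ord0 i)]).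
  - by apply: (preimage_closed (f := N) (D := [set x | x = 1]));
      [move=> x _; exact: cN|exact: closed_eq].
  - apply: (@rV_compact R (Zp_trunc n).+2 (fun=> `[-1, 1]%classic)) => _.
    exact: segment_compact.
  - move=> v vA i /=; rewrite in_itv/= -ler_norml -[leRHS]sqrtr1 -sqrtr_sqr.
    rewrite ler_wsqrtr// -vA /N (bigD1 (i : 'Z_n))//= ler_wpDr// sumr_ge0//.
    by move=> j _; exact: sqr_ge0.
have A0 : A !=set0.
  exists (\row_(i < (Zp_trunc n).+2) (i == 0)%:R); rewrite /A /= /N.
  rewrite (bigD1 (0 : 'Z_n))//= mxE eqxx expr1n big1 ?addr0// => i /negbTE i0.
  by rewrite mxE i0 expr0n.
have [v vA vmax] := EVT_max_rV A0 cA (continuous_subspaceT cF).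
exists (fun i => v 0 i); first by have := set_mem vA.
move=> f f1; have := vmax (\row_i f i).
have rf : (fun i : 'Z_n => (\row_j f j) 0 i) = f.
  by apply/funext => i; rewrite mxE.
rewrite /F rf; apply; apply/mem_set; rewrite /A /= /N.
by under eq_bigr do rewrite mxE.
Qed.

Definition maximises_free_energy {R : realType} {n : nat} (a : R)
    (u : 'Z_n -> R) :=
  [/\ \sum_i u i ^+ 2 = 1, forall i, 0 <= u i &
    forall f : 'Z_n -> R, \sum_i f i ^+ 2 = 1 ->
      free_energy a f <= free_energy a u].

(** Replacing [u] by its absolute value does not increase the differences. *)
Lemma free_energy_nonneg_maximiser {R : realType} {n : nat} (a : R) :
  exists u : 'Z_n -> R, maximises_free_energy a u.
Proof.
have [u u1 umax] := @free_energy_maximiser R n a.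
have sqE i : `|u i| ^+ 2 = u i ^+ 2 by rewrite real_normK ?num_real.
exists (fun i => `|u i|); split=> //; first by under eq_bigr do rewrite sqE.
move=> f f1; apply: (le_trans (umax f f1)); rewrite /free_energy.
have -> : \sum_i xlnx (`|u i| ^+ 2) = \sum_i xlnx (u i ^+ 2).
  by apply: eq_bigr => i _; rewrite sqE.
rewrite lerB//.
rewrite ler_pM2l//; apply: ler_sum => i _.
by rewrite -[leRHS]real_normK ?num_real// -[leLHS]real_normK ?num_real//
  lerXn2r ?nnegrE ?ler_dist_dist.
Qed.

(** Frees the maximum from its constraint: both sides are multiplied by [c ^+ 2]
    and gain the same entropy term when [f] is multiplied by [c]. *)
Lemma free_energy_le_scaled {R : realType} {n : nat} (a M : R) :
  (forall f : 'Z_n -> R, \sum_i f i ^+ 2 = 1 -> free_energy a f <= M) ->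
  forall f : 'Z_n -> R,
    free_energy a f <= M * \sum_i f i ^+ 2 + a / 2 * xlnx (\sum_i f i ^+ 2).
Proof.
move=> Mmax f; set N := \sum_i f i ^+ 2.
have N0 : 0 <= N by rewrite sumr_ge0// => i _; rewrite sqr_ge0.
have [Nz|Nn0] := eqVneq N 0.
  have f0 i : f i = 0.
    apply/eqP; rewrite -sqrf_eq0.
    by have := psumr_eq0P (fun i _ => sqr_ge0 (f i)) Nz => ->.
  rewrite Nz /free_energy /xlnx mulr0 mul0r mulr0 addr0.
  rewrite !big1 ?(mulr0, subrr)// => i _; rewrite !f0 ?subrr expr0n//= mul0r//.
have {N0}N0 : 0 < N by rewrite lt_neqAle eq_sym Nn0.
pose c := Num.sqrt N; have c0 : 0 < c by rewrite sqrtr_gt0.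
have c2 : c ^+ 2 = N by rewrite sqr_sqrtr// ltW.
pose g i := f i / c.
have fE i : f i = c * g i by rewrite mulrC divfK// gt_eqF.
have g1 : \sum_i g i ^+ 2 = 1.
  rewrite /g; under eq_bigr do rewrite exprMn exprVn c2.
  by rewrite -mulr_suml divff.
have -> : free_energy a f = N * free_energy a g + a / 2 * xlnx N.
  rewrite /free_energy.
  have -> : \sum_i xlnx (f i ^+ 2) = N * (\sum_i xlnx (g i ^+ 2)) + xlnx N.
    rewrite -[X in _ + X]mulr1 -g1 !mulr_sumr -big_split; apply: eq_bigr => i _.
    by rewrite fE exprMn c2 xlnx_scale// sqr_ge0.
  have -> : \sum_i (f i - f (i + 1)) ^+ 2 = N * \sum_i (g i - g (i + 1)) ^+ 2.
    by rewrite mulr_sumr; apply: eq_bigr => i _; rewrite !fE -mulrBr exprMn c2.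
  ring.
by rewrite lerD2r mulrC ler_pM2r//; exact: Mmax.
Qed.

(** * The Euler-Lagrange equation *)

Lemma sum_point_massM {R : realType} {n : nat} (i : 'Z_n) (F : 'Z_n -> R) :
  \sum_j (j == i)%:R * F j = F i.
Proof.
rewrite (bigD1 i)//= eqxx mul1r big1 ?addr0// => j /negbTE ->.
by rewrite mul0r.
Qed.

Definition perturb {R : realType} {n : nat} (u : 'Z_n -> R) (i : 'Z_n) (t : R) :
  'Z_n -> R := fun j => u j + t * (j == i)%:R.

Lemma sum_perturb_sqr {R : realType} {n : nat} (u : 'Z_n -> R) i t :
  \sum_j perturb u i t j ^+ 2 = \sum_j u j ^+ 2 + t * (2 * u i + t).
Proof.
transitivity (\sum_j (u j ^+ 2 + t * ((j == i)%:R * (2 * u j + t)))).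
  by apply: eq_bigr => j _; rewrite /perturb; case: eqP => _ /=; ring.
by rewrite big_split/= -mulr_sumr sum_point_massM.
Qed.

Lemma sum_perturb_xlnx {R : realType} {n : nat} (u : 'Z_n -> R) i t :
  \sum_j xlnx (perturb u i t j ^+ 2) =
  \sum_j xlnx (u j ^+ 2) + (xlnx ((u i + t) ^+ 2) - xlnx (u i ^+ 2)).
Proof.
transitivity (\sum_j (xlnx (u j ^+ 2) +
    (j == i)%:R * (xlnx ((u j + t) ^+ 2) - xlnx (u j ^+ 2)))).
  apply: eq_bigr => j _; rewrite /perturb; case: eqP => _ /=.
    by rewrite mulr1; ring.
  by rewrite mulr0 addr0; ring.
by rewrite big_split/= sum_point_massM.
Qed.

Lemma sum_perturb_diffsq {R : realType} {n : nat} (u : 'Z_n -> R) i t :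
  \sum_j (perturb u i t j - perturb u i t (j + 1)) ^+ 2 =
  \sum_j (u j - u (j + 1)) ^+ 2 + 2 * t * (2 * u i - u (i + 1) - u (i - 1) + t).
Proof.
rewrite !sum_cycle_diffsq sum_perturb_sqr.
have -> : \sum_j perturb u i t j * perturb u i t (j + 1) =
    \sum_j u j * u (j + 1) + t * (u (i + 1) + u (i - 1)).
  transitivity (\sum_j (u j * u (j + 1) + t * ((j == i)%:R * u (j + 1))
      + t * (u j * (j + 1 == i)%:R))).
    apply: eq_bigr => j _; rewrite /perturb.
    have : (j == i)%:R * (j + 1 == i)%:R = 0 :> R.
      have [->|_] := eqVneq j i; last by rewrite mul0r.
      by rewrite -subr_eq0 addrC addKr oner_eq0 mulr0.
    nra.
  rewrite !big_split/= -!mulr_sumr sum_point_massM.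
  have -> : \sum_j u j * (j + 1 == i)%:R = u (i - 1).
    rewrite -[RHS](sum_point_massM i (fun j => u (j - 1))).
    rewrite -[RHS]sum_cycle_shift.
    by apply: eq_bigr => j _; rewrite addrK mulrC.
  ring.
ring.
Qed.

Lemma le0_of_le_small_mul {R : realType} (x K t0 : R) : 0 < t0 ->
  (forall t, 0 < t -> t <= t0 -> x <= t * K) -> x <= 0.
Proof.
move=> t00 H; rewrite leNgt; apply/negP => x0.
have K0 : 0 < K by have := H _ t00 (lexx _); nra.
have := H (Num.min t0 (x / (2 * K))).
rewrite lt_min ge_min lexx t00 divr_gt0 ?mulr_gt0// => /(_ isT isT).
have : Num.min t0 (x / (2 * K)) <= x / (2 * K) by rewrite ge_min lexx orbT.
by rewrite ler_pdivlMr ?mulr_gt0//; lra.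
Qed.

Lemma eq0_of_linear_dominated {R : realType} (A K : R) :
  (forall t, `|t| <= 1 -> 0 <= t * A + t ^+ 2 * K) -> A = 0.
Proof.
move=> H; apply/eqP; rewrite eq_le -[0 <= A]oppr_le0.
have scaled t x : 0 < t -> 0 <= t * (t * K - x) -> x <= t * K.
  by move=> t0; rewrite pmulr_rge0// subr_ge0.
apply/andP; split; apply: (le0_of_le_small_mul _ K 1) => // t t0 t1;
  apply: scaled => //.
- by have := H (- t); rewrite normrN gtr0_norm// => /(_ t1); lra.
- by have := H t; rewrite gtr0_norm// => /(_ t1); lra.
Qed.

(** Maximality tested on [perturb u i t]. A polynomial bounds the entropy of the
    total mass, so that [xlnx] survives at vertex [i] only. *)
Lemma maximiser_perturb {R : realType} {n : nat} (a : R) (u : 'Z_n -> R) i t :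
  0 < a -> maximises_free_energy a u ->
  a / 2 * (xlnx ((u i + t) ^+ 2) - xlnx (u i ^+ 2))
    - t * (2 * u i - u (i + 1) - u (i - 1) + t) <=
  free_energy a u * (t * (2 * u i + t))
    + a / 2 * ((1 + t * (2 * u i + t)) * (t * (2 * u i + t))).
Proof.
move=> a0 [u1 _ umax].
have := free_energy_le_scaled _ _ umax (perturb u i t).
rewrite [X in X <= _]/free_energy.
rewrite sum_perturb_xlnx sum_perturb_diffsq sum_perturb_sqr u1.
have ME : free_energy a u = a / 2 * \sum_j xlnx (u j ^+ 2)
  - 2^-1 * \sum_j (u j - u (j + 1)) ^+ 2 by [].
set M := free_energy a u in ME *.
set q := t * (2 * u i + t).
have q0 : 0 <= 1 + q.
  by rewrite -u1 -sum_perturb_sqr sumr_ge0// => j _; exact: sqr_ge0.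
have qq : xlnx (1 + q) <= (1 + q) * q.
  move: q0; rewrite le_eqVlt /xlnx => /orP[/eqP <-|q0]; first by rewrite !mul0r.
  by rewrite ler_pM2l// (le_trans (ln_le_sub1 _ q0))// addrC addKr.
have : a / 2 * xlnx (1 + q) <= a / 2 * ((1 + q) * q).
  by rewrite ler_pM2l// divr_gt0.
move: ME; set Su := \sum_j _; set Du := \sum_j _; lra.
Qed.

(** Raising a zero value to a small [t > 0] changes the entropy by [o(t)] only,
    while the differences gain [t * (u (j + 1) + u (j - 1))]; at a maximum this
    gain must vanish. So zeros propagate around the cycle. *)
Lemma maximiser_gt0 {R : realType} {n : nat} (a : R) (u : 'Z_n -> R) :
  0 < a -> maximises_free_energy a u -> forall i, 0 < u i.
Proof.
move=> a0 um i; have [u1 u0 umax] := um.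
rewrite lt_neqAle u0 andbT eq_sym; apply/negP => /eqP ui.
have next j : u j = 0 -> u (j + 1) = 0.
  move=> uj; pose s0 := u (j + 1) + u (j - 1).
  pose K := 1 + `|free_energy a u| + 3 * a.
  (* For t = s ^+ 2 the entropy term is bounded by a multiple of s ^+ 3. *)
  have s0K s : 0 < s -> s <= 1 -> s0 <= s * K.
    move=> sp s1; have := maximiser_perturb a u j (s ^+ 2) a0 um.
    have x0 : xlnx 0 = 0 :> R by rewrite /xlnx mul0r.
    rewrite uj add0r expr0n /= x0 => H1.
    have : s ^+ 4 * (4 * (1 - s^-1)) <= xlnx ((s ^+ 2) ^+ 2).
      rewrite /xlnx !ln_sqr ?exprn_gt0// -exprM ler_pM2l ?exprn_gt0//.
      by have := ln_ge_1sub_inv _ sp; lra.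
    have -> : s ^+ 4 * (4 * (1 - s^-1)) = 4 * s ^+ 4 - 4 * s ^+ 3.
      by field; rewrite gt_eqF.
    set X := xlnx _ in H1 * => H2.
    have H3 : a / 2 * (4 * s ^+ 4 - 4 * s ^+ 3) <= a / 2 * X.
      by rewrite ler_pM2l ?divr_gt0.
    have H4 : s ^+ 2 * s0 <= s ^+ 2 * (s ^+ 2 * (1 + free_energy a u)
        + a / 2 * (s ^+ 2 + s ^+ 6) - 2 * a * s ^+ 2 + 2 * a * s).
      by rewrite /s0; lra.
    move: H4; rewrite ler_pM2l ?exprn_gt0// => /le_trans; apply.
    have s2 : s ^+ 2 <= s by rewrite expr2 ger_pMr.
    have s6 : s ^+ 6 <= s by rewrite exprS ger_pMr// exprn_ile1// ltW.
    have s20 : 0 <= s ^+ 2 := sqr_ge0 s.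
    have F1 : s ^+ 2 * free_energy a u <= s ^+ 2 * `|free_energy a u|.
      by rewrite ler_wpM2l// ler_norm.
    have F2 : s ^+ 2 * (1 + `|free_energy a u|) <= s * (1 + `|free_energy a u|).
      by rewrite ler_wpM2r// addr_ge0.
    have F3 : a / 2 * (s ^+ 2 + s ^+ 6) <= a / 2 * (s + s).
      by rewrite ler_pM2l ?divr_gt0// lerD.
    have F4 : 0 <= a * s ^+ 2 by rewrite mulr_ge0// ltW.
    by rewrite /K; lra.
  have s00 : s0 <= 0.
    by apply: (le0_of_le_small_mul _ K 1) => // s sp s1; exact: s0K.
  by have := u0 (j + 1); have := u0 (j - 1); move: s00; rewrite /s0; lra.
have uz j : u j = 0.
  have H k : u (i + k%:R) = 0.
    elim: k => [|k IH]; first by rewrite addr0.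
    by rewrite -natr1 addrA; exact: next.
  by have := H (j - i)%R; rewrite natr_Zp addrC subrK.
by move: u1; rewrite big1 => [/eqP|j _]; rewrite ?uz ?expr0n// eq_sym oner_eq0.
Qed.

(** Since [u i > 0], the tangent of [xlnx] at [u i ^+ 2] turns
    [maximiser_perturb] into a polynomial inequality in [t], whose linear
    coefficient must vanish. *)
Lemma maximiser_euler_lagrange {R : realType} {n : nat} (a : R)
    (u : 'Z_n -> R) i :
  0 < a -> maximises_free_energy a u ->
  (u (i + 1) + u (i - 1)) / (2 * u i) = 1 + free_energy a u - a * ln (u i).
Proof.
move=> a0 um; have ui := maximiser_gt0 a u a0 um i.
set M := free_energy a u.
pose A := 2 * M * u i + a * u i - a * (1 + ln (u i ^+ 2)) * u i
  + (2 * u i - u (i + 1) - u (i - 1)).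
have A0 : A = 0.
  pose c := M + a / 2 - a / 2 * (1 + ln (u i ^+ 2)) + 1.
  pose K := 1 + `|c| + a / 2 * (2 * u i + 1) ^+ 2.
  apply: (eq0_of_linear_dominated _ K) => t t1.
  have := maximiser_perturb a u i t a0 um; rewrite -/M => H1.
  have := xlnx_tangent (u i ^+ 2) ((u i + t) ^+ 2).
  rewrite exprn_gt0// sqr_ge0 => /(_ isT isT) H2.
  have H3 : a / 2 * (xlnx (u i ^+ 2)
        + (1 + ln (u i ^+ 2)) * ((u i + t) ^+ 2 - u i ^+ 2)) <=
      a / 2 * xlnx ((u i + t) ^+ 2) by rewrite ler_pM2l ?divr_gt0.
  have H4 : 0 <= t * A + t ^+ 2 * (c + a / 2 * (2 * u i + t) ^+ 2).
    by rewrite /A /c; nra.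
  apply: (le_trans H4); rewrite lerD2l ler_wpM2l ?sqr_ge0//.
  rewrite /K; apply: lerD; first by rewrite (le_trans (ler_norm _))// lerDr.
  rewrite ler_pM2l ?divr_gt0//; move: t1; rewrite ler_norml => /andP[? ?]; nra.
move: A0; rewrite /A ln_sqr// => A0.
have -> : u (i + 1) + u (i - 1) = 2 * u i * (1 + M - a * ln (u i)) by lra.
by rewrite mulrC mulKf// mulf_neq0 ?gt_eqF.
Qed.

(** * From the Poincare to the logarithmic Sobolev inequality *)

(** The factor 2 comes from the factor 1/2 in the Dirichlet form. *)
Definition cycle_poincare {R : realType} (n : nat) (lam : R) :=
  forall f : 'Z_n -> R, \sum_i f i = 0 ->
    2 * lam * \sum_i f i ^+ 2 <= \sum_i (f i - f (i + 1)) ^+ 2.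

(** The Euler-Lagrange equation makes [neighbour_ratio] of the increments [d] of
    [ln u] an affine function of [ln u], as [cycle_rigidity] requires. The
    resulting bound on [d] is incompatible with the Poincare inequality, unless
    [d = 0]. *)
Lemma maximiser_constant {R : realType} {n : nat} (a lam : R) (u : 'Z_n -> R) :
  0 < a <= 1 -> a < lam -> cycle_poincare n lam ->
  maximises_free_energy a u -> forall i, u i = u 0.
Proof.
move=> a01 alam poinc um; have [a0 a1] := andP a01.
have u0 := maximiser_gt0 a u a0 um.
pose d i := ln (u (i + 1)) - ln (u i).
have etaE i : neighbour_ratio (d (i - 1)) (d i) =
    1 + free_energy a u - a * ln (u i).
  rewrite -(maximiser_euler_lagrange a u i a0 um).
  rewrite /neighbour_ratio /d subrK opprB.
  by rewrite -!ln_div ?posrE// !lnK ?posrE ?divr_gt0//; field; rewrite gt_eqF.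
have eta1 i : neighbour_ratio (d i) (d (i + 1)) =
    1 + free_energy a u - a * ln (u (i + 1)).
  by rewrite -etaE addrK.
have dE i : neighbour_ratio (d (i - 1)) (d i)
    - neighbour_ratio (d i) (d (i + 1)) = a * d i.
  by rewrite etaE eta1 /d; ring.
have rig := cycle_rigidity a d a01 dE.
have sd : \sum_i d i = 0.
  by rewrite /d sumrB (sum_cycle_shift (fun i => ln (u i))) subrr.
have d2 : \sum_i d i ^+ 2 = 0.
  have := poinc d sd; have : 0 <= \sum_i d i ^+ 2.
    by rewrite sumr_ge0// => i _; exact: sqr_ge0.
  nra.
have dz i : d i = 0.
  apply/eqP; rewrite -sqrf_eq0.
  by have := psumr_eq0P (fun i _ => sqr_ge0 (d i)) d2 => ->.
have us i : u (i + 1) = u i.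
  apply: ln_inj; rewrite ?posrE//.
  by apply/eqP; rewrite -subr_eq0; apply/eqP/dz.
have H k : u k%:R = u 0.
  by elim: k => [//|k IH]; rewrite -natr1 us.
by move=> i; rewrite -[i]natr_Zp H.
Qed.

(** The maximal free energy is that of the constants, namely
    [- (a / 2 * ln n)]; [free_energy_le_scaled] then is the claim, multiplied
    by [n]. *)
Lemma log_sobolev_of_poincare {R : realType} {n : nat} (a lam : R)
    (f : 'Z_n -> R) :
  (1 < n)%N -> 0 < a <= 1 -> a < lam -> cycle_poincare n lam ->
  a / 2 * cycle_entropy (fun i => f i ^+ 2) <= cycle_dirichlet f.
Proof.
move=> n1 a01 alam poinc; have [a0 a1] := andP a01.
have [u um] := @free_energy_nonneg_maximiser R n a.
have [u1 _ umax] := um.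
have uc := maximiser_constant a lam u a01 alam poinc um.
have n0 : 0 < n%:R :> R by rewrite ltr0n (ltn_trans _ n1).
have sumc (c : R) : \sum_(i : 'Z_n) c = n%:R * c.
  by rewrite sumr_const card_ord Zp_cast// mulr_natl.
have u2 : u 0 ^+ 2 = n%:R^-1.
  apply: (mulfI (lt0r_neq0 n0)); rewrite mulfV ?gt_eqF// -sumc -[RHS]u1.
  by apply: eq_bigr => i _; rewrite uc.
have FE : free_energy a u = - (a / 2 * ln n%:R).
  rewrite /free_energy [X in _ - _ * X]big1 ?mulr0 ?subr0; last first.
    by move=> i _; rewrite uc [u (i + 1)]uc subrr expr0n.
  under eq_bigr do rewrite uc u2.
  by rewrite sumc /xlnx lnV ?posrE//; field; rewrite gt_eqF.
have := free_energy_le_scaled _ _ umax f; rewrite FE.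
rewrite /cycle_entropy /cycle_dirichlet /cycle_average /free_energy.
set N := \sum_i f i ^+ 2; set D := \sum_i (_ - _) ^+ 2.
have -> : \sum_i f i ^+ 2 * ln (f i ^+ 2) = \sum_i xlnx (f i ^+ 2) by [].
set S := \sum_i xlnx _.
have N0 : 0 <= N by rewrite sumr_ge0// => i _; rewrite sqr_ge0.
have -> : n%:R^-1 * N * ln (n%:R^-1 * N) = n%:R^-1 * (xlnx N - N * ln n%:R).
  rewrite -/(xlnx (n%:R^-1 * N)) xlnx_scale ?invr_gt0// /xlnx lnV ?posrE//.
  ring.
move=> H; have : n%:R^-1 * (a / 2 * S - 2^-1 * D) <=
    n%:R^-1 * (- (a / 2 * ln n%:R) * N + a / 2 * xlnx N).
  by rewrite ler_pM2l ?invr_gt0.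
rewrite invfM; lra.
Qed.

(** Second-order Taylor expansion with an explicit remainder, from the rational
    lower bounds of [ln (1 + x)] valid for each sign of [x]. *)
Lemma xlnx_sqr_1Dx_ge {R : realType} (x : R) : -1 < x ->
  2 * x + 3 * x ^+ 2 - `|x| ^+ 3 <= xlnx ((1 + x) ^+ 2).
Proof.
move=> x1; have r0 : 0 < 1 + x by lra.
rewrite /xlnx ln_sqr//; have [x0|x0] := leP 0 x.
  have := ln_ge_pade (1 + x); rewrite lerDl => /(_ x0) H.
  rewrite ger0_norm// -(ler_pM2r (x := 1 + x + 1)); last by lra.
  have : 2 * (1 + x) ^+ 2 * (2 * (1 + x - 1)) <=
      2 * (1 + x) ^+ 2 * (ln (1 + x) * (1 + x + 1)).
    by rewrite ler_pM2l// mulr_gt0// exprn_gt0.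
  have : 0 <= x ^+ 3 by rewrite exprn_ge0.
  have : 0 <= x ^+ 4 by rewrite exprn_ge0.
  lra.
have := ln_le_sub_inv (1 + x)^-1; rewrite invf_ge1// invrK lnV ?posrE// => H.
have {}H := H (_ : 1 + x <= 1).
have {}H : (1 + x) ^+ 2 * (1 + x - (1 + x)^-1) <=
    (1 + x) ^+ 2 * (2 * ln (1 + x)).
  by rewrite ler_pM2l ?exprn_gt0//; lra.
apply: le_trans H; rewrite ltr0_norm//.
have -> : (1 + x) ^+ 2 * (1 + x - (1 + x)^-1) = (1 + x) ^+ 3 - (1 + x).
  by field; rewrite gt_eqF.
lra.
Qed.

(** * The two constants as optimal constants *)

Lemma cycle_dirichlet_ge0 {R : realType} {n : nat} (f : 'Z_n -> R) :
  0 <= cycle_dirichlet f.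
Proof.
rewrite mulr_ge0 ?invr_ge0 ?mulr_ge0 ?ler0n//.
by rewrite sumr_ge0// => i _; exact: sqr_ge0.
Qed.

Lemma spectral_gap_le {R : realType} {n : nat} (f : 'Z_n -> R) :
  0 < cycle_variance f ->
  spectral_gap R n <= cycle_dirichlet f / cycle_variance f.
Proof.
move=> f0; apply: ge_inf; last by exists f.
by exists 0 => _ [g /= g0 <-]; rewrite divr_ge0 ?cycle_dirichlet_ge0// ltW.
Qed.

Lemma log_sobolev_constant_le {R : realType} {n : nat} (f : 'Z_n -> R) :
  0 < cycle_entropy (fun i => f i ^+ 2) ->
  log_sobolev_constant R n <=
  cycle_dirichlet f / cycle_entropy (fun i => f i ^+ 2).
Proof.
move=> f0; apply: ge_inf; last by exists f.
by exists 0 => _ [g /= g0 <-]; rewrite divr_ge0 ?cycle_dirichlet_ge0// ltW.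
Qed.

(** An empty set of quotients has infimum 0. *)
Lemma log_sobolev_constant_ge0 {R : realType} {n : nat} :
  0 <= log_sobolev_constant R n.
Proof.
rewrite /log_sobolev_constant; set S := [set _ | _ in _].
have [->|/set0P S0] := eqVneq S set0; first by rewrite inf0.
apply: lb_le_inf => // _ [g /= g0 <-].
by rewrite divr_ge0 ?cycle_dirichlet_ge0// ltW.
Qed.

Lemma spectral_gap_poincare {R : realType} {n : nat} :
  (1 < n)%N -> cycle_poincare n (spectral_gap R n).
Proof.
move=> n1 f f0; have n0 : 0 < n%:R :> R by rewrite ltr0n (ltn_trans _ n1).
set N := \sum_i f i ^+ 2.
have N0 : 0 <= N by rewrite sumr_ge0// => i _; rewrite sqr_ge0.
have [Nz|Nn0] := eqVneq N 0.
  by rewrite Nz mulr0 sumr_ge0// => i _; rewrite sqr_ge0.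
have {N0}N0 : 0 < N by rewrite lt_neqAle eq_sym Nn0.
have vE : cycle_variance f = n%:R^-1 * N.
  by rewrite /cycle_variance /cycle_average f0 mulr0 expr0n subr0.
have := spectral_gap_le f.
rewrite vE mulr_gt0 ?invr_gt0// => /(_ isT).
rewrite ler_pdivlMr ?mulr_gt0 ?invr_gt0// /cycle_dirichlet.
set D := \sum_i (_ - _) ^+ 2 => H.
have : spectral_gap R n * (n%:R^-1 * N) * (2 * n%:R) <=
    (2 * n%:R)^-1 * D * (2 * n%:R).
  by rewrite ler_pM2r// mulr_gt0.
have -> : (2 * n%:R)^-1 * D * (2 * n%:R) = D by field; rewrite gt_eqF.
have -> : spectral_gap R n * (n%:R^-1 * N) * (2 * n%:R) =
    2 * spectral_gap R n * N.
  by field; rewrite gt_eqF.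
by [].
Qed.

Lemma Zn_natr_eq (n k l : nat) : (1 < n)%N -> (k < n)%N -> (l < n)%N ->
  (k%:R == l%:R :> 'Z_n) = (k == l).
Proof. by move=> n1 kn ln; rewrite -val_eqE /= !val_Zp_nat// !modn_small. Qed.

(** The test function is 1 at vertex 0, -1 at vertex 2 and 0 elsewhere. For
    [n >= 4] the values at adjacent vertices have product 0, so that its
    quotient is 1. On the triangle, vertices 0 and 2 are adjacent. *)
Lemma spectral_gap_le1 {R : realType} {n : nat} :
  (4 <= n)%N -> spectral_gap R n <= 1.
Proof.
move=> n4; have n1 : (1 < n)%N by exact: leq_trans n4.
pose f (i : 'Z_n) : R := (i == 0%:R)%:R - (i == 2%:R)%:R.
have fsum (G : 'Z_n -> R) : \sum_i f i * G i = G 0%:R - G 2%:R.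
  rewrite -[G 0%:R]sum_point_massM -[G 2%:R]sum_point_massM -sumrB.
  by apply: eq_bigr => i _; rewrite /f mulrBl.
have fE k : (k < n)%N -> f k%:R = (k == 0)%:R - (k == 2)%:R.
  by move=> kn; rewrite /f !Zn_natr_eq//; exact: leq_trans n4.
have f0 : \sum_i f i = 0.
  rewrite -[RHS](subrr 1) -(fsum (fun=> 1)).
  by apply: eq_bigr => i _; rewrite mulr1.
have f2 : \sum_i f i ^+ 2 = 2.
  by rewrite (fsum f) !fE ?(leq_trans _ n4)//=; ring.
have ff : \sum_i f i * f (i + 1) = 0.
  by rewrite (fsum (fun i => f (i + 1))) !natr1 !fE ?subrr// (leq_trans _ n4).
have := spectral_gap_poincare n1 f f0.
by rewrite sum_cycle_diffsq f2 ff; lra.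
Qed.

(** * Linearisation and the theorem *)

Lemma sum_cycle_const {R : realType} {n : nat} (c : R) : (1 < n)%N ->
  \sum_(i : 'Z_n) c = n%:R * c.
Proof. by move=> n1; rewrite sumr_const card_ord Zp_cast// mulr_natl. Qed.

Definition point_mass {R : realType} {n : nat} (i : 'Z_n) : R := (i == 0)%:R.

Lemma point_mass_sqr {R : realType} {n : nat} :
  (fun i => point_mass i ^+ 2) = @point_mass R n.
Proof.
by apply/funext => i; rewrite /point_mass; case: eqP; rewrite ?expr1n ?expr0n.
Qed.

Lemma cycle_average_point_mass {R : realType} {n : nat} :
  cycle_average (@point_mass R n) = n%:R^-1.
Proof.
rewrite /cycle_average -[RHS]mulr1; congr (_ * _).
have := @sum_point_massM R n 0 (fun=> 1) => <-.
by apply: eq_bigr => i _; rewrite mulr1.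
Qed.

Lemma variance_point_mass_gt0 {R : realType} {n : nat} : (1 < n)%N ->
  0 < cycle_variance (@point_mass R n).
Proof.
move=> n1; have n0 : 0 < n%:R :> R by rewrite ltr0n (ltn_trans _ n1).
rewrite /cycle_variance point_mass_sqr cycle_average_point_mass.
rewrite subr_gt0 expr2 gtr_pMr ?invr_gt0// invf_lt1// (ltr_nat R 1).
exact: n1.
Qed.

Lemma entropy_point_mass_gt0 {R : realType} {n : nat} : (1 < n)%N ->
  0 < cycle_entropy (fun i => @point_mass R n i ^+ 2).
Proof.
move=> n1; have n0 : 0 < n%:R :> R by rewrite ltr0n (ltn_trans _ n1).
rewrite point_mass_sqr /cycle_entropy cycle_average_point_mass.
rewrite [cycle_average _]/cycle_average sum_point_massM {1}/point_mass eqxx ln1.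
rewrite mulr0 sub0r lnV ?posrE// mulrN opprK mulr_gt0 ?invr_gt0//.
by rewrite ln_gt0// (ltr_nat R 1).
Qed.

(** At order [t ^+ 2], [xlnx_sqr_1Dx_ge] contributes three times the mean of
    [g ^+ 2], and the entropy of the mean removes one of them. *)
Lemma entropy_perturbation_ge {R : realType} {n : nat} (g : 'Z_n -> R) (t : R) :
  (1 < n)%N -> \sum_i g i = 0 -> 0 < t -> t <= 1 ->
  (forall i, t * `|g i| <= 2^-1) ->
  t ^+ 2 * (2 * cycle_average (fun i => g i ^+ 2)) -
    t ^+ 3 * (cycle_average (fun i => `|g i| ^+ 3)
              + cycle_average (fun i => g i ^+ 2) ^+ 2) <=
  cycle_entropy (fun i => (1 + t * g i) ^+ 2).
Proof.
move=> n1 g0 t0 t1 tg.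
have n0 : 0 < n%:R :> R by rewrite ltr0n (ltn_trans _ n1).
set v := cycle_average (fun i => g i ^+ 2).
set m := cycle_average (fun i => `|g i| ^+ 3).
have v0 : 0 <= v.
  by rewrite mulr_ge0 ?invr_ge0 ?ler0n// sumr_ge0// => i _; exact: sqr_ge0.
have avE : cycle_average (fun i => (1 + t * g i) ^+ 2) = 1 + t ^+ 2 * v.
  rewrite /v /cycle_average.
  have -> : \sum_i (1 + t * g i) ^+ 2 =
      \sum_(i : 'Z_n) 1 + (2 * t) * \sum_i g i + t ^+ 2 * \sum_i g i ^+ 2.
    rewrite !mulr_sumr -!big_split/=; apply: eq_bigr => i _; ring.
  by rewrite g0 sum_cycle_const//; field; rewrite gt_eqF.
have main : 3 * t ^+ 2 * v - t ^+ 3 * m <=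
    cycle_average (fun i => (1 + t * g i) ^+ 2 * ln ((1 + t * g i) ^+ 2)).
  apply: (@le_trans _ _ (n%:R^-1 * (2 * t * \sum_i g i
      + 3 * t ^+ 2 * (\sum_i g i ^+ 2) - t ^+ 3 * \sum_i `|g i| ^+ 3))).
    rewrite g0 /v /m /cycle_average le_eqVlt; apply/orP; left; apply/eqP.
    ring.
  rewrite /cycle_average ler_pM2l ?invr_gt0// !mulr_sumr -big_split -sumrB/=.
  apply: ler_sum => i _.
  have ti : -1 < t * g i.
    have := tg i; have := ler_norm (- g i); rewrite normrN => ? ?; nra.
  apply: le_trans (xlnx_sqr_1Dx_ge (t * g i) ti).
  by rewrite normrM (gtr0_norm t0) !exprMn; lra.
rewrite /cycle_entropy avE.
have q0 : 0 < 1 + t ^+ 2 * v.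
  have tv : 0 <= t ^+ 2 * v by apply: mulr_ge0 => //; exact: sqr_ge0.
  by lra.
have : (1 + t ^+ 2 * v) * ln (1 + t ^+ 2 * v) <=
    (1 + t ^+ 2 * v) * (t ^+ 2 * v).
  by rewrite ler_pM2l// (le_trans (ln_le_sub1 _ q0))// addrC addKr.
have : t ^+ 4 * v ^+ 2 <= t ^+ 3 * v ^+ 2.
  by rewrite ler_wpM2r ?sqr_ge0// ler_wiXn2l// ltW.
lra.
Qed.

Lemma cycle_dirichlet_affine {R : realType} {n : nat} (f : 'Z_n -> R)
    (c t : R) :
  cycle_dirichlet (fun i => 1 + t * (f i - c)) = t ^+ 2 * cycle_dirichlet f.
Proof.
rewrite /cycle_dirichlet [RHS]mulrCA [X in _ = _ * X]mulr_sumr; congr (_ * _).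
by apply: eq_bigr => i _; ring.
Qed.

(** Tests the constant on [1 + t * g] for small [t > 0], where [g] is [f] minus
    its average. *)
Lemma log_sobolev_constant_le_quotient {R : realType} {n : nat}
    (f : 'Z_n -> R) :
  (1 < n)%N -> 0 < cycle_variance f ->
  2 * log_sobolev_constant R n * cycle_variance f <= cycle_dirichlet f.
Proof.
move=> n1 v0; have n0 : 0 < n%:R :> R by rewrite ltr0n (ltn_trans _ n1).
pose c := cycle_average f; pose g i := f i - c.
have sf : \sum_i f i = n%:R * c.
  by rewrite /c /cycle_average mulrA mulfV ?mul1r ?gt_eqF.
have g0 : \sum_i g i = 0 by rewrite sumrB sum_cycle_const// sf subrr.
have vE : cycle_average (fun i => g i ^+ 2) = cycle_variance f.
  rewrite /cycle_variance -/c /cycle_average.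
  have -> : \sum_i g i ^+ 2 =
      \sum_i f i ^+ 2 - 2 * c * \sum_i f i + \sum_(i : 'Z_n) c ^+ 2.
    rewrite mulr_sumr -sumrB -big_split.
    by apply: eq_bigr => i _; rewrite /g/=; ring.
  by rewrite sum_cycle_const// sf; field; rewrite gt_eqF.
set v := cycle_variance f in v0 vE *; set al := log_sobolev_constant R n.
pose K := cycle_average (fun i => `|g i| ^+ 3) + v ^+ 2.
have K0 : 0 <= K.
  apply: addr_ge0; last exact: sqr_ge0.
  apply: mulr_ge0; first by rewrite invr_ge0 ler0n.
  by apply: sumr_ge0 => i _; exact: exprn_ge0.
have al0 : 0 <= al := log_sobolev_constant_ge0.
pose B := \sum_i `|g i|.
have B0 : 0 <= B by rewrite sumr_ge0.
have gB i : `|g i| <= B by rewrite /B (bigD1 i)//= ler_wpDr ?sumr_ge0.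
pose t0 := Num.min 1 (Num.min (2 * (B + 1))^-1 (v / (K + 1))).
have t00 : 0 < t0.
  by rewrite !lt_min ltr01 invr_gt0 mulr_gt0 ?divr_gt0//= ltr_wpDl.
rewrite -subr_le0; apply: (le0_of_le_small_mul _ (al * K) t0 t00) => t tp.
rewrite /t0 !le_min => /and3P[t1 tB tK].
have tg i : t * `|g i| <= 2^-1.
  have : t * (2 * (B + 1)) <= 1.
    by rewrite -ler_pdivlMr ?mul1r// mulr_gt0// ltr_wpDl.
  by have := gB i; nra.
have tKv : t * (K + 1) <= v by rewrite -ler_pdivlMr// ltr_wpDl.
have := entropy_perturbation_ge g t n1 g0 tp t1 tg; rewrite vE -/K.
set En := cycle_entropy _ => EnE.
have low : 0 < t ^+ 2 * (2 * v) - t ^+ 3 * K.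
  have -> : t ^+ 2 * (2 * v) - t ^+ 3 * K = t ^+ 2 * (2 * v - t * K) by ring.
  by rewrite mulr_gt0 ?exprn_gt0//; lra.
have En0 : 0 < En := lt_le_trans low EnE.
have := log_sobolev_constant_le _ En0; rewrite cycle_dirichlet_affine -/al -/En.
rewrite ler_pdivlMr// => H.
have H2 : al * (t ^+ 2 * (2 * v) - t ^+ 3 * K) <= al * En by rewrite ler_wpM2l.
rewrite -(ler_pM2l (x := t ^+ 2)) ?exprn_gt0//; lra.
Qed.

Theorem theorem1 (R : realType) (n : nat) (hn : (4 <= n)%N) :
  log_sobolev_constant R n = spectral_gap R n / 2.
Proof.
have n1 : (1 < n)%N by exact: leq_trans hn.
apply/eqP; rewrite eq_le; apply/andP; split.
  rewrite ler_pdivlMr//; apply: lb_le_inf.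
    exists (cycle_dirichlet (@point_mass R n)
      / cycle_variance (@point_mass R n)).
    by exists point_mass; first exact: variance_point_mass_gt0.
  move=> _ [f /= f0 <-]; rewrite ler_pdivlMr//.
  by rewrite [_ * 2]mulrC; exact: log_sobolev_constant_le_quotient.
apply: lb_le_inf.
  exists (cycle_dirichlet (@point_mass R n)
    / cycle_entropy (fun i => @point_mass R n i ^+ 2)).
  by exists point_mass; first exact: entropy_point_mass_gt0.
move=> _ [f /= f0 <-]; set r := cycle_dirichlet f / _.
have r0 : 0 <= r by rewrite divr_ge0 ?cycle_dirichlet_ge0// ltW.
rewrite leNgt; apply/negP => rl.
have := @spectral_gap_le1 R n hn; have := @spectral_gap_poincare R n n1.
move: rl; set lam := spectral_gap R n => rl poinc l1.
(* If the quotient r were below lam / 2, the midpoint a of 2 r and lam would be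
   below lam and yet exceed 2 r. *)
pose a := r + lam / 2.
have a01 : 0 < a <= 1 by apply/andP; rewrite /a; split; lra.
have al : a < lam by rewrite /a; lra.
have := log_sobolev_of_poincare a lam f n1 a01 al poinc.
by rewrite -ler_pdivlMr// -/r /a; lra.
Qed.
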